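(* Let $h:\mathbb{N}\to\mathbb{N}$ be a computable non-decreasing function. The following are equivalent: (a) for every c.e. set $A\subseteq\mathbb{N}$ there is a constant $c$ such that $K(A\restriction_n)\leq h(n)+\log n+c$ for all $n\geq 1$; (b) $\sum_n 2^{-h(n)}$ is finite.
   Context: $K$ denotes prefix-free Kolmogorov complexity; $A\restriction_n$ is the string of the first $n$ bits of the characteristic sequence of $A$; $\log$ is base 2. *)

(* Defs.v *)
From mathcomp Require Import all_boot all_order all_algebra.
From mathcomp Require Import all_classical all_reals all_analysis.

Set Implicit Arguments.
Unset Strict Implicit.
Unset Printing Implicit Defensive.

Import Order.TTheory GRing.Theory Num.Theory.

Local Open Scope nat_scope.

(* Syntax of the n-ary partial recursive functions on nat. *)
Inductive murec : nat -> Type :=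
| Zero : murec 0
| Succ : murec 1
| Proj n (i : 'I_n) : murec n
| Comp m n (f : murec m) (g : 'I_m -> murec n) : murec n
| Prec n (f : murec n) (g : murec n.+2) : murec n.+1
| Mu n (f : murec n.+1) : murec n.

(* [eval f v y] means that f converges on v with value y.
   Primitive recursion is on the first argument: with F := Prec f g,
     F(0, v) = f(v)   and   F(k+1, v) = g(k, F(k, v), v);
   the function t below lists F(0, v), F(1, v), up to the required value.
   Minimisation is over the first argument of f, and requires f to converge
   at all smaller arguments. *)
Fixpoint eval n (f : murec n) : n.-tuple nat -> nat -> Prop :=
  match f in murec n return n.-tuple nat -> nat -> Prop with
  | Zero => fun _ y => y = 0
  | Succ => fun v y => y = (thead v).+1
  | Proj _ i => fun v y => y = tnth v i
  | Comp m _ f g => fun v y =>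
      exists2 w : m.-tuple nat,
        forall i, eval (g i) v (tnth w i) & eval f w y
  | Prec _ f g => fun v y =>
      exists t : nat -> nat,
        [/\ eval f [tuple of behead v] (t 0),
            forall k, k < thead v ->
              eval g [tuple of k :: t k :: behead v] (t k.+1)
          & y = t (thead v)]
  | Mu _ f => fun v y =>
      eval f [tuple of y :: v] 0 /\
      forall k, k < y -> exists z, eval f [tuple of k :: v] z.+1
  end.

Lemma eval_fun n (f : murec n) v y z : eval f v y -> eval f v z -> y = z.
Proof.
elim: f v y z => {n} [||n i|m n f IHf g IHg|n f IHf g IHg|n f IHf] v y z /=.
- by move=> -> ->.
- by move=> -> ->.
- by move=> -> ->.
- move=> [w gw fw] [w' gw' fw']; have eq_w : w = w'.
    by apply: eq_from_tnth => i; apply: IHg (gw i) (gw' i).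
  by apply: IHf fw _; rewrite eq_w.
- move=> [t [t0 tS ->]] [u [u0 uS ->]].
  suff E k : k <= thead v -> t k = u k by apply: E.
  elim: k => [_|k IHk lt_kv]; first exact: IHf t0 u0.
  by apply: IHg (tS k lt_kv) _; rewrite IHk 1?ltnW //; apply: uS.
- move=> [fy ltfy] [fz ltfz]; case: (ltngtP y z) => // [/ltfz|/ltfy] [k fk].
    by have := IHf _ _ _ fy fk.
  by have := IHf _ _ _ fz fk.
Qed.

Definition computable (h : nat -> nat) : Prop :=
  exists f : murec 1, forall n, eval f [tuple n] (h n).

Definition ce (A : set nat) : Prop :=
  exists f : murec 1, forall n, A n <-> exists y, eval f [tuple n] y.

(* Bijective base-2 numeration, least significant digit first. *)
Definition nat_of_str (s : seq bool) : nat :=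
  foldr (fun (b : bool) k => (k.*2 + b).+1) 0 s.

Lemma nat_of_str_inj : injective nat_of_str.
Proof.
elim=> [|b s IHs] [|c t] //= [] E.
have bc : b = c.
  by move/(congr1 odd): E; rewrite !oddD !odd_double !oddb.
by rewrite bc in E *; congr (_ :: _); apply/IHs/double_inj/(addIn E).
Qed.

Lemma nat_of_str_surj n : exists s, nat_of_str s = n.
Proof.
elim/ltn_ind: n => -[_|n IHn]; first by exists [::].
have [|s sE] := IHn n./2.
  by rewrite ltnS -{2}[n]odd_double_half -addnn addnCA leq_addr.
by exists (odd n :: s); rewrite /= sE addnC odd_double_half.
Qed.

(* Every unary partial recursive function is read as a partial function on
   binary strings, and this gives all partial computable ones, since
   [nat_of_str] is an effective bijection. *)
Definition outputs (M : murec 1) (p x : seq bool) : Prop :=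
  eval M [tuple nat_of_str p] (nat_of_str x).

Definition prefix_free (M : murec 1) : Prop :=
  forall p q x y, outputs M p x -> outputs M q y -> prefix p q -> p = q.

Definition optimal (U : murec 1) : Prop :=
  prefix_free U /\
  forall M, prefix_free M ->
    exists c : nat, forall p x, outputs M p x ->
      exists2 q, outputs U q x & size q <= size p + c.

(* Length of a shortest U-description of x; +oo if there is none, which does
   not happen when U is optimal. *)
Definition K (R : realType) (U : murec 1) (x : seq bool) : \bar R :=
  ereal_inf [set ((size p)%:R%:E)%R | p in [set p | outputs U p x]]%classic.

Definition restr (A : set nat) (n : nat) : seq bool :=
  mkseq (fun i => `[< A i >]) n.

Definition log2 (R : realType) (x : R) : R := (ln x / ln 2)%R.

(* Main.v *)
(**
(b) => (a): A restricted to n is determined by n and the number m <= n of its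
ones. Since h is nondecreasing, a prefix-free code giving (n, m) a word of
length h(n) + log n + O(1) is obtained by allocating intervals from left to
right; it exists as the sum over m <= n of the weights is of order 2^-h(n).

(a) => (b): enumerate A in stages. A number x with attached constant c enters
A as soon as U has described the current A restricted to n with at most
h(n) + log n + c bits for every n in (x, 2x]. These x descriptions weigh at
least 2^-(h(2x) + c + 2) together, and the entrance of x makes them obsolete,
so the descriptions used for different x are different. If (a) holds for A
with constant c, then every x with attached constant c enters, and Kraft's
inequality bounds the sum of 2^-h(2x) over these x. They form an arithmetic
progression, so (b) follows by monotonicity of h.
*)

Require Import Defs.
From mathcomp Require Import all_boot all_order all_algebra.
From mathcomp Require Import all_classical all_reals all_analysis.

From mathcomp Require Import ring zify.

Set Implicit Arguments.
Unset Strict Implicit.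
Unset Printing Implicit Defensive.

Import Order.TTheory GRing.Theory Num.Theory.

Local Open Scope nat_scope.

(* MathComp-Analysis has another [eval]. *)
Local Notation eval := Defs.eval.

(** * Closure properties of total recursive functions *)

(* The second component [p.2] of a context is the head of the tuple of
   arguments, that is, the innermost bound variable; [p.1.2] is the next one,
   and so on. *)
Fixpoint ctx n : Type := if n is m.+1 then (ctx m * nat)%type else unit.

Fixpoint ctx_of n : n.-tuple nat -> ctx n :=
  match n with
  | 0 => fun _ => tt
  | m.+1 => fun v => (ctx_of [tuple of behead v], thead v)
  end.

Definition recursive n (F : ctx n -> nat) : Prop :=
  exists f : murec n, forall v : n.-tuple nat, eval f v (F (ctx_of v)).
Arguments recursive : clear implicits.

Lemma ctx_of_cons n k (v : n.-tuple nat) :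
  ctx_of [tuple of k :: v] = (ctx_of v, k).
Proof. by rewrite /=; congr (ctx_of _, _); apply: val_inj. Qed.

Lemma recursive_ext n (F G : ctx n -> nat) :
  recursive n F -> F =1 G -> recursive n G.
Proof. by move=> rF /funext <-. Qed.

(** * Substitution and change of variables *)

Lemma recursive_comp m n (F : ctx m -> nat) (W : ctx n -> m.-tuple nat) :
  recursive m F -> (forall i, recursive n (fun x => tnth (W x) i)) ->
  recursive n (fun x => F (ctx_of (W x))).
Proof.
move=> [f fF] /choice[g gW]; exists (Comp f g) => v /=.
by exists (W (ctx_of v)).
Qed.

(** [Comp] needs its intermediate values as a tuple, so a substitution of contexts is given through
    a tuple [w x] that [ctx_of] maps to it. *)
Definition recursive_ctx n m (W : ctx n -> ctx m) : Prop :=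
  exists2 w : ctx n -> m.-tuple nat, forall x, ctx_of (w x) = W x
    & forall i, recursive n (fun x => tnth (w x) i).
Arguments recursive_ctx : clear implicits.

Lemma recursive_subst m n (F : ctx m -> nat) (W : ctx n -> ctx m) :
  recursive m F -> recursive_ctx n m W -> recursive n (fun x => F (W x)).
Proof.
move=> rF [w wW rw]; apply: recursive_ext (recursive_comp rF rw) _ => x.
by rewrite wW.
Qed.

Lemma recursive_var0 n : recursive n.+1 (fun p => p.2).
Proof. by exists (Proj ord0) => v /=. Qed.

Lemma tnth_behead_lift T n (v : n.+1.-tuple T) i :
  tnth [tuple of behead v] i = tnth v (lift ord0 i).
Proof.
by case: v / tupleP => x v; rewrite tnthS; congr (tnth _ _); apply: val_inj.
Qed.

Lemma recursive_weak n (F : ctx n -> nat) :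
  recursive n F -> recursive n.+1 (fun p => F p.1).
Proof.
move=> [f fF]; exists (Comp f (fun i => Proj (lift ord0 i))) => v /=.
by exists [tuple of behead v] => // i; rewrite tnth_behead_lift.
Qed.

Lemma recursive_ctx_cons n m (W : ctx n -> ctx m) (F : ctx n -> nat) :
  recursive_ctx n m W -> recursive n F ->
  recursive_ctx n m.+1 (fun x => (W x, F x)).
Proof.
move=> [w wW rw] rF; exists (fun x => [tuple of F x :: w x]) => [x|j].
  by rewrite ctx_of_cons wW.
case: (unliftP ord0 j) => [i|] -> //.
by apply: recursive_ext (rw i) _ => x; rewrite tnthS.
Qed.

Lemma recursive_ctx_weak n m (W : ctx n -> ctx m) :
  recursive_ctx n m W -> recursive_ctx n.+1 m (fun p => W p.1).
Proof.
move=> [w wW rw]; exists (fun p => w p.1) => [p|i]; first exact: wW.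
exact: (recursive_weak (rw i)).
Qed.

Lemma recursive_ctx_id n : recursive_ctx n n id.
Proof.
elim: n => [|n IHn]; first by exists (fun=> [tuple]) => [[]|[]].
have := recursive_ctx_cons (recursive_ctx_weak IHn) (recursive_var0 n).
by congr recursive_ctx; apply/funext => -[].
Qed.

Lemma recursive_ctx_drop2 n : recursive_ctx n.+2 n (fun p => p.1.1).
Proof. exact: recursive_ctx_weak (recursive_ctx_weak (recursive_ctx_id n)). Qed.

(** Meant for primitive recursions, where the accumulator lies between the parameters and the
    counter and has to be discarded. *)
Lemma recursive_weak1 n (F : ctx n -> nat -> nat) :
  recursive n.+1 (fun p => F p.1 p.2) ->
  recursive n.+2 (fun p => F p.1.1 p.2).
Proof.
move=> rF; pose W (p : ctx n.+2) : ctx n.+1 := (p.1.1, p.2).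
apply: (recursive_subst (W := W)) rF _.
apply: recursive_ctx_cons _ (recursive_var0 _).
exact: recursive_ctx_drop2.
Qed.

Lemma recursive_weak2 n (F : ctx n -> nat) :
  recursive n F -> recursive n.+2 (fun p => F p.1.1).
Proof. by move=> /recursive_weak; apply: recursive_weak. Qed.

Lemma recursive_let n (F : ctx n.+1 -> nat) (G : ctx n -> nat) :
  recursive n.+1 F -> recursive n G -> recursive n (fun x => F (x, G x)).
Proof.
by move=> rF /(recursive_ctx_cons (recursive_ctx_id n)); apply: recursive_subst.
Qed.

Lemma recursive1 n (f : nat -> nat) (F : ctx n -> nat) :
  recursive 1 (fun p => f p.2) -> recursive n F -> recursive n (fun x => f (F x)).
Proof.
move=> rf rF; apply: (recursive_comp (W := fun x => [tuple F x])) rf _ => i.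
by apply: recursive_ext rF _ => x; rewrite (ord1 i).
Qed.

Lemma recursive2 n (f : nat -> nat -> nat) (F G : ctx n -> nat) :
  recursive 2 (fun p => f p.1.2 p.2) -> recursive n F -> recursive n G ->
  recursive n (fun x => f (F x) (G x)).
Proof.
move=> rf rF rG.
(* The head of the tuple is the last variable of the context, hence the reversed order. *)
apply: (recursive_comp (W := fun x => [tuple G x; F x])) rf _ => -[[|[|//]] lti].
  exact: recursive_ext rG _.
exact: recursive_ext rF _.
Qed.

Lemma recursive_var1 n : recursive n.+2 (fun p => p.1.2).
Proof. exact: recursive_weak (recursive_var0 n). Qed.

Lemma recursive_var2 n : recursive n.+3 (fun p => p.1.1.2).
Proof. exact: recursive_weak (recursive_var1 n). Qed.

Lemma recursive_var3 n : recursive n.+4 (fun p => p.1.1.1.2).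
Proof. exact: recursive_weak (recursive_var2 n). Qed.

Lemma recursive_var4 n : recursive n.+4.+1 (fun p => p.1.1.1.1.2).
Proof. exact: recursive_weak (recursive_var3 n). Qed.

(** * Primitive recursion and arithmetic *)

Lemma recursive_prec n (f : ctx n -> nat) (g : ctx n -> nat -> nat -> nat)
    (F : ctx n -> nat -> nat) :
    recursive n f -> recursive n.+2 (fun p => g p.1.1 p.1.2 p.2) ->
    (forall x, F x 0 = f x) -> (forall x k, F x k.+1 = g x (F x k) k) ->
  recursive n.+1 (fun p => F p.1 p.2).
Proof.
move=> [f' f'P] [g' g'P] F0 FS; exists (Prec f' g') => v /=.
exists (F (ctx_of [tuple of behead v])); split=> [|k _|//]; first by rewrite F0.
rewrite FS; have := g'P [tuple of k :: F (ctx_of [tuple of behead v]) k :: behead v].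
by rewrite !ctx_of_cons.
Qed.

Lemma recursive_const n k : recursive n (fun=> k).
Proof.
elim: k => [|k [f fk]]; last first.
  by exists (Comp Succ (fun=> f)) => v /=; exists [tuple k] => // i; rewrite (ord1 i).
(* [Zero] has arity 0, so the constant 0 of arity [n] is its composition with an empty family. *)
exists (Comp Zero (fun i : 'I_0 => False_rect (murec n) (notF (ltn_ord i)))) => v.
by exists [tuple] => // -[].
Qed.

Lemma recursive_succ n (F : ctx n -> nat) :
  recursive n F -> recursive n (fun x => (F x).+1).
Proof. by apply: recursive1; exists Succ. Qed.

Lemma recursive_rec n (f : ctx n -> nat) (g : ctx n -> nat -> nat -> nat)
    (F : ctx n -> nat -> nat) (K : ctx n -> nat) :
    (forall x, F x 0 = f x) -> (forall x k, F x k.+1 = g x (F x k) k) ->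
    recursive n f -> recursive n.+2 (fun p => g p.1.1 p.1.2 p.2) ->
  recursive n K -> recursive n (fun x => F x (K x)).
Proof.
move=> F0 FS rf rg rK.
exact: (recursive_let (recursive_prec rf rg F0 FS) rK).
Qed.

Lemma recursive_pred n (F : ctx n -> nat) :
  recursive n F -> recursive n (fun x => (F x).-1).
Proof.
move=> rF; apply: (@recursive_rec n (fun=> 0) (fun _ _ k => k) (fun _ => predn)) => //.
  exact: recursive_const.
exact: recursive_var0.
Qed.

Lemma recursive_add n (F G : ctx n -> nat) :
  recursive n F -> recursive n G -> recursive n (fun x => F x + G x).
Proof.
move=> rF rG.
apply: (@recursive_rec n F (fun _ a _ => a.+1) (fun x k => F x + k)) => //.
- by move=> x; rewrite addn0.
- by move=> x k; rewrite addnS.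
- exact/recursive_succ/recursive_var1.
Qed.

Lemma recursive_sub n (F G : ctx n -> nat) :
  recursive n F -> recursive n G -> recursive n (fun x => F x - G x).
Proof.
move=> rF rG.
apply: (@recursive_rec n F (fun _ a _ => a.-1) (fun x k => F x - k)) => //.
- by move=> x; rewrite subn0.
- by move=> x k; rewrite subnS.
- exact/recursive_pred/recursive_var1.
Qed.

Lemma recursive_mul n (F G : ctx n -> nat) :
  recursive n F -> recursive n G -> recursive n (fun x => F x * G x).
Proof.
move=> rF rG.
apply: (@recursive_rec n (fun=> 0) (fun x a _ => F x + a) (fun x k => F x * k)) => //.
- by move=> x; rewrite muln0.
- by move=> x k; rewrite mulnS.
- exact: recursive_const.
- apply: recursive_add; last exact: recursive_var1.
  exact: recursive_weak2 rF.
Qed.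

Lemma recursive_exp n (F G : ctx n -> nat) :
  recursive n F -> recursive n G -> recursive n (fun x => F x ^ G x).
Proof.
move=> rF rG.
apply: (@recursive_rec n (fun=> 1) (fun x a _ => F x * a) (fun x k => F x ^ k)) => //.
- by move=> x k; rewrite expnS.
- exact: recursive_const.
- apply: recursive_mul; last exact: recursive_var1.
  exact: recursive_weak2 rF.
Qed.

Lemma recursive_sum n (B : ctx n -> nat) (T : ctx n -> nat -> nat) :
  recursive n B -> recursive n.+1 (fun p => T p.1 p.2) ->
  recursive n (fun x => \sum_(0 <= i < B x) T x i).
Proof.
move=> rB rT.
apply: (@recursive_rec n (fun=> 0) (fun x a k => a + T x k)
  (fun x k => \sum_(0 <= i < k) T x i)) => //.
- by move=> x; rewrite big_geq.
- by move=> x k; rewrite big_nat_recr.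
- exact: recursive_const.
- apply: recursive_add; first exact: recursive_var1.
  exact: (recursive_weak1 (F := T)).
Qed.

Lemma recursive_prod n (B : ctx n -> nat) (T : ctx n -> nat -> nat) :
  recursive n B -> recursive n.+1 (fun p => T p.1 p.2) ->
  recursive n (fun x => \prod_(0 <= i < B x) T x i).
Proof.
move=> rB rT.
apply: (@recursive_rec n (fun=> 1) (fun x a k => a * T x k)
  (fun x k => \prod_(0 <= i < k) T x i)) => //.
- by move=> x; rewrite big_geq.
- by move=> x k; rewrite big_nat_recr.
- exact: recursive_const.
- apply: recursive_mul; first exact: recursive_var1.
  exact: (recursive_weak1 (F := T)).
Qed.

Lemma recursive_prod_fin n m (T : 'I_m -> ctx n -> nat) :
  (forall i, recursive n (T i)) -> recursive n (fun x => \prod_(i < m) T i x).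
Proof.
move=> rT; elim: (index_enum _) => [|i r IHr].
  by apply: recursive_ext (recursive_const n 1) _ => x; rewrite big_nil.
by apply: recursive_ext (recursive_mul (rT i) IHr) _ => x; rewrite big_cons.
Qed.

(** * Predicates as 0-1 valued functions, and functions given by counting *)

Lemma recursive_leq n (F G : ctx n -> nat) :
  recursive n F -> recursive n G -> recursive n (fun x => F x <= G x).
Proof.
move=> rF rG; have := recursive_sub (recursive_const n 1) (recursive_sub rF rG).
by move=> /recursive_ext; apply=> x; rewrite -subn_eq0; case: (F x - G x).
Qed.

Lemma recursive_eq n (F G : ctx n -> nat) :
  recursive n F -> recursive n G -> recursive n (fun x => F x == G x).
Proof.
move=> rF rG; have := recursive_mul (recursive_leq rF rG) (recursive_leq rG rF).
by move=> /recursive_ext; apply=> x; rewrite eqn_leq mulnb.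
Qed.

Lemma recursive_odd n (F : ctx n -> nat) :
  recursive n F -> recursive n (fun x => odd (F x)).
Proof.
move=> rF; apply: (@recursive_rec n (fun=> 0) (fun _ a _ => 1 - a)
  (fun _ k => odd k)) => //.
- by move=> _ k /=; case: (odd k).
- exact: recursive_const.
- by apply: recursive_sub; [exact: recursive_const | exact: recursive_var1].
Qed.

(** Lets quotients and logarithms be written as the number of [i] below a bound that pass a downward
    closed test. *)
Lemma sum_nat_ltn n k : k <= n -> \sum_(0 <= i < n) (i < k) = k.
Proof.
move=> le_kn; rewrite (big_cat_nat (leq0n k) le_kn) /= big_nat_cond.
rewrite (eq_bigr (fun=> 1)) => [|i /andP[/andP[_ ->]]//].
rewrite -big_nat_cond sum_nat_const_nat subn0 muln1 big_nat_cond big1 ?addn0 //.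
by move=> i /andP[/andP[]]; rewrite leqNgt => /negPf->.
Qed.

Lemma recursive_div n (F G : ctx n -> nat) :
  recursive n F -> recursive n G -> recursive n (fun x => F x %/ G x).
Proof.
move=> rF rG.
(* The factor [0 < G x] gives the value 0 for division by 0, where the count alone would be
   [F x]. *)
have r : recursive n (fun x =>
    (0 < G x) * \sum_(0 <= i < F x) (i.+1 * G x <= F x)).
  apply: recursive_mul; first exact: (recursive_leq (recursive_const n 1) rG).
  apply: (recursive_sum rF); apply: recursive_leq; last exact: (recursive_weak rF).
  apply: (fun r => recursive_mul r (recursive_weak rG)).
  exact/recursive_succ/recursive_var0.
apply: recursive_ext r _ => x; case: posnP => [->|G0]; first by rewrite divn0.
rewrite mul1n -[RHS](sum_nat_ltn (leq_div _ _)).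
by apply: eq_bigr => i _; rewrite leq_divRL.
Qed.

Lemma recursive_dvd n (F G : ctx n -> nat) :
  recursive n F -> recursive n G -> recursive n (fun x => F x %| G x).
Proof.
move=> rF rG; have := recursive_eq (recursive_mul (recursive_div rG rF) rF) rG.
by move=> /recursive_ext; apply=> x; rewrite dvdn_eq.
Qed.

Lemma recursive_log n (F : ctx n -> nat) :
  recursive n F -> recursive n (fun x => trunc_log 2 (F x)).
Proof.
move=> rF.
have r : recursive n (fun x => \sum_(0 <= i < F x) (2 ^ i.+1 <= F x)).
  apply: (recursive_sum rF); apply: recursive_leq; last exact: (recursive_weak rF).
  apply: recursive_exp; first exact: recursive_const.
  exact/recursive_succ/recursive_var0.
apply: recursive_ext r _ => x; have [->|F0] := posnP (F x).
  by rewrite big_geq // trunc_log0.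
have le_log : trunc_log 2 (F x) <= F x.
  by apply: leq_trans (trunc_logP (ltnSn 1) F0); apply/ltnW/ltn_expl.
rewrite -[RHS](sum_nat_ltn le_log).
apply: eq_bigr => i _; congr (nat_of_bool _); apply/idP/idP => [|lt_i].
  exact: trunc_log_max.
by apply: leq_trans (trunc_logP (ltnSn 1) F0); rewrite leq_exp2l.
Qed.

Lemma recursive_val2 n (F : ctx n -> nat) :
  recursive n F -> recursive n (fun x => logn 2 (F x).+1).
Proof.
move=> rF.
have r : recursive n (fun x => \sum_(0 <= i < F x) (2 ^ i.+1 %| (F x).+1)).
  apply: (recursive_sum rF); apply: recursive_dvd; last first.
    exact/recursive_succ/recursive_weak.
  apply: recursive_exp; first exact: recursive_const.
  exact/recursive_succ/recursive_var0.
apply: recursive_ext r _ => x.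
by rewrite logn_count_dvd // big_add1.
Qed.

Lemma recursive_and n (P Q : ctx n -> bool) :
  recursive n (fun x => P x) -> recursive n (fun x => Q x) ->
  recursive n (fun x => P x && Q x).
Proof.
by move=> rP /(recursive_mul rP)/recursive_ext; apply=> x; rewrite mulnb.
Qed.

Lemma recursive_not n (P : ctx n -> bool) :
  recursive n (fun x => P x) -> recursive n (fun x => ~~ P x).
Proof.
move=> /(recursive_sub (recursive_const n 1))/recursive_ext; apply=> x.
by case: (P x).
Qed.

Lemma recursive_all n (P : ctx n -> nat -> bool) (B : ctx n -> nat) :
  recursive n B -> recursive n.+1 (fun p => P p.1 p.2) ->
  recursive n (fun x => all (P x) (iota 0 (B x))).
Proof.
move=> rB /(recursive_prod (T := fun x i => P x i) rB)/recursive_ext; apply=> x.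
elim: (B x) => [|k IHk]; first by rewrite big_geq.
by rewrite -[in RHS]addn1 iotaD all_cat /= andbT big_nat_recr //= IHk mulnb.
Qed.

Lemma recursive_has n (P : ctx n -> nat -> bool) (B : ctx n -> nat) :
  recursive n B -> recursive n.+1 (fun p => P p.1 p.2) ->
  recursive n (fun x => has (P x) (iota 0 (B x))).
Proof.
move=> rB rP; have /(recursive_all (P := fun x i => ~~ P x i) rB) := recursive_not rP.
move=> /recursive_not/recursive_ext; apply=> x; rewrite -has_predC.
by congr (nat_of_bool _); apply: eq_has => i; rewrite /= negbK.
Qed.

(** Selecting a unique witness becomes a bounded sum, hence recursive. *)
Lemma sum_nat_unique (f : nat -> nat) (P : pred nat) n i :
  {in P &, forall j k, j = k} -> P i -> i < n ->
  \sum_(0 <= j < n) f j * P j = f i.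
Proof.
move=> uP Pi lt_in; rewrite big_mkord (bigD1 (Ordinal lt_in)) //= Pi muln1.
rewrite big1 ?addn0 // => j /negP neq_ji.
case: (boolP (P j)) => Pj; last by rewrite muln0.
by case: neq_ji; apply/eqP/val_inj/uP.
Qed.

(** * Stage-bounded evaluation and unbounded search *)

(* [G x s = y.+1] when the computation on [x] halts with value [y] within
   resource bound [s], and [G x s = 0] when it does not. *)
Lemma clock n (f : murec n) :
  exists G : ctx n -> nat -> nat,
    [/\ recursive n.+1 (fun p => G p.1 p.2),
        forall x s t y, s <= t -> G x s = y.+1 -> G x t = y.+1
      & forall v y, eval f v y <-> exists s, G (ctx_of v) s = y.+1].
Proof.
elim: f => {n} [||n i|m n f IHf g IHg|n f IHf g IHg|n f IHf].
- exists (fun _ _ => 1); split=> [|//|v y /=]; first exact: recursive_const.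
  by split=> [->|[_ [->]]//]; exists 0.
- exists (fun x _ => x.2.+2); split=> [|//|v y /=].
    exact/recursive_succ/recursive_succ/recursive_var1.
  by split=> [->|[_ [->]]//]; exists 0.
- have [F [rF FE]] : exists F, recursive n F /\ forall v, F (ctx_of v) = tnth v i.
    elim: n i => [[]//|n IHn] i; case: (unliftP ord0 i) => [j|] ->; last first.
      by exists snd; split=> //; apply: recursive_var0.
    have [F [rF FE]] := IHn j; exists (fun x => F x.1).
    by split=> [|v]; [apply: recursive_weak | rewrite FE tnth_behead_lift].
  exists (fun x _ => (F x).+1); split=> [|//|v y /=].
    exact/recursive_succ/recursive_weak.
  by rewrite FE; split=> [->|[_ [->]]//]; exists 0.
- have [F [rF Fmono FP]] := IHf; have [G GP] := choice IHg.
  (* All computations share the bound [s]. The product vanishes unless every inner one has halted,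
     and [.-1] recovers their outputs. *)
  pose W x s := [tuple (G i x s).-1 | i < m].
  exists (fun x s => \prod_(i < m) (0 < G i x s) * F (ctx_of (W x s)) s).
  have posE x s y : \prod_(i < m) (0 < G i x s) * F (ctx_of (W x s)) s = y.+1 <->
      (forall i, 0 < G i x s) /\ F (ctx_of (W x s)) s = y.+1.
    split=> [E|[G0 ->]]; last by rewrite big1 ?mul1n // => i _; rewrite G0.
    have G0 i : 0 < G i x s.
      by move: E; rewrite (bigD1 i) //=; case: (0 < G i x s).
    by move: E; rewrite big1 ?mul1n // => i _; rewrite G0.
  split=> [|x s t y le_st|v y].
  + apply: recursive_mul.
      apply: recursive_prod_fin => i; apply: recursive_leq; first exact: recursive_const.
      by have [] := GP i.
    pose W' (p : ctx n.+1) := [tuple of p.2 :: W p.1 p.2].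
    apply: (recursive_ext (recursive_comp (W := W') rF _)) => [j|p].
      case: (unliftP ord0 j) => [i|] ->; last exact: recursive_var0.
      have [rG _ _] := GP i; apply: recursive_ext (recursive_pred rG) _ => p.
      by rewrite tnthS tnth_mktuple.
    by rewrite /W' ctx_of_cons.
  + move=> /posE[G0 E]; apply/posE.
    have GE i : G i x t = G i x s.
      have [_ Gmono _] := GP i; rewrite -(prednK (G0 i)).
      by apply: Gmono le_st _; rewrite prednK.
    split=> [i|]; first by rewrite GE.
    apply: Fmono le_st _; rewrite -E; congr (F (ctx_of _) _).
    by apply: eq_from_tnth => i; rewrite !tnth_mktuple GE.
  split=> [/= [w gw /FP[s0 Fs0]]|[s /posE[G0 E]]].
    have /choice[s sP] i : exists s, G i (ctx_of v) s = (tnth w i).+1.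
      by have [_ _ <-] := GP i.
    exists (maxn s0 (\max_i s i)); apply/posE.
    have GE i : G i (ctx_of v) (maxn s0 (\max_i s i)) = (tnth w i).+1.
      have [_ Gmono _] := GP i; apply: Gmono (sP i).
      by rewrite leq_max (leq_bigmax i) orbT.
    split=> [i|]; first by rewrite GE.
    apply: Fmono (leq_maxl _ _) _; rewrite -Fs0; congr (F (ctx_of _) _).
    by apply: eq_from_tnth => i; rewrite tnth_mktuple GE.
  exists (W (ctx_of v) s) => [i|]; last by apply/FP; exists s.
  by have [_ _ ->] := GP i; exists s; rewrite tnth_mktuple prednK.
- have [F [rF Fmono FP]] := IHf; have [G [rG Gmono GP]] := IHg.
  (* The accumulator is itself a clock value: the factor [0 < a] propagates a failure to halt, and
     [a.-1] is the value passed to [g]. *)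
  pose step s x a k := (0 < a) * G (x, a.-1, k) s.
  pose T s x k := nat_rec (fun=> nat) (F x s) (fun k a => step s x a k) k.
  exists (fun x s => T s x.1 x.2).
  have TS s x k y : T s x k.+1 = y.+1 <->
      exists2 z, T s x k = z.+1 & G (x, z, k) s = y.+1.
    rewrite /= /step; case: (T s x k) => [|z] /=; first by split=> // -[].
    by rewrite mul1n; split=> [|[_ [<-]]//]; exists z.
  have Tmono s t x k y : s <= t -> T s x k = y.+1 -> T t x k = y.+1.
    move=> le_st; elim: k y => [|k IHk] y; first exact: Fmono.
    move=> /TS[z /IHk Tz Gy]; apply/TS; exists z => //.
    exact: Gmono Gy.
  split=> [|x s t y|v y].
  + pose R (p : ctx n.+2) k := T p.2 p.1.1 k.
    apply: (@recursive_rec n.+2 (fun p => F p.1.1 p.2)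
      (fun p a k => step p.2 p.1.1 a k) R (fun p => p.1.2)) => //.
    - exact: recursive_weak1 rF.
    - apply: recursive_mul.
        by apply: recursive_leq; [exact: recursive_const | exact: recursive_var1].
      pose W (q : ctx n.+4) : ctx n.+3 := (q.1.1.1.1, q.1.2.-1, q.2, q.1.1.2).
      apply: (recursive_subst (W := W)) rG _.
      apply: recursive_ctx_cons _ (recursive_var2 _).
      apply: recursive_ctx_cons _ (recursive_var0 _).
      apply: recursive_ctx_cons _ (recursive_pred (recursive_var1 _)).
      exact: recursive_ctx_weak (recursive_ctx_weak (recursive_ctx_drop2 _)).
    - exact: recursive_var1.
  + exact: Tmono.
  split=> [/= [t [/FP[s0 Es0] tS ->]]|].
    elim: (thead v) tS => [|k IHk] tS; first by exists s0.
    have [|s1 E1] := IHk; first by move=> j lt_jk; apply/tS/ltnW.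
    have [s2 E2] := (GP _ _).1 (tS k (ltnSn k)).
    exists (maxn s1 s2); apply/TS; exists (t k).
      exact: Tmono (leq_maxl _ _) E1.
    by rewrite !ctx_of_cons in E2; apply: Gmono (leq_maxr _ _) E2.
  move=> [s E]; exists (fun k => (T s (ctx_of [tuple of behead v]) k).-1).
  (* Failure propagates upwards, so descending from [thead v] shows that all earlier values have
     converged. *)
  have Tpos k : k <= thead v -> 0 < T s (ctx_of [tuple of behead v]) k.
    move=> le_kv; rewrite -(subKn le_kv).
    elim: (thead v - k) => [|j IHj]; first by rewrite subn0 E.
    case: (ltnP j (thead v)) => [lt_jv|]; last first.
      by move=> le_vj; move: IHj; rewrite (eqP le_vj) (eqP (leqW le_vj)).
    move: IHj; rewrite subnS -(prednK (n := thead v - j)) ?subn_gt0 //.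
    by rewrite [X in X -> _]/= /step; case: (T _ _ _).
  split; last by rewrite /= in E *; rewrite E.
    by apply/FP; exists s; rewrite prednK //; apply: (Tpos 0).
  move=> k lt_kv; apply/GP; exists s; rewrite !ctx_of_cons.
  have := Tpos _ lt_kv; case Ek: (T _ _ _) => [//|y'] _.
  by have [z -> /= ->] := (TS _ _ _ _).1 Ek.
- have [F [rF Fmono FP]] := IHf.
  (* Clock value 1 stands for output 0, and a clock value above 1 for a positive output: [P s x y]
     says that minimisation is seen to stop at [y]. *)
  pose P s x y := (F (x, y) s == 1) && all (fun k => 1 < F (x, k) s) (iota 0 y).
  have uP s x : {in P s x &, forall j k, j = k}.
    move=> j k /andP[/eqP Fj /allP ltj] /andP[/eqP Fk /allP ltk].
    case: (ltngtP j k) => // [lt_jk|lt_kj].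
      by have := ltk j; rewrite mem_iota lt_jk Fj => /(_ isT).
    by have := ltj k; rewrite mem_iota lt_kj Fk => /(_ isT).
  exists (fun x s => \sum_(0 <= y < s) y.+1 * P s x y).
  have sumE s x y : \sum_(0 <= y < s) y.+1 * P s x y = y.+1 <-> P s x y /\ y < s.
    split=> [E|[Py lt_ys]]; last first.
      exact: (@sum_nat_unique succn (P s x) s _ (uP s x) Py lt_ys).
    have [z lt_zs Pz] : exists2 z, z < s & P s x z.
      apply: contrapT => nP; move: E; rewrite big_nat big1 // => z /andP[_ lt_zs].
      by case: (boolP (P s x z)) => [Pz|]; [case: nP; exists z | rewrite muln0].
    by move: E; rewrite (@sum_nat_unique succn (P s x) s _ (uP s x) Pz lt_zs) => -[<-].
  split=> [|x s t y le_st|v y].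
  + apply: recursive_sum; first exact: recursive_var0.
    apply: recursive_mul; first exact/recursive_succ/recursive_var0.
    apply: recursive_and.
      apply: recursive_eq (recursive_const _ _).
      pose W (q : ctx n.+2) : ctx n.+2 := (q.1.1, q.2, q.1.2).
      apply: (recursive_subst (W := W)) rF _.
      apply: recursive_ctx_cons _ (recursive_var1 _).
      apply: recursive_ctx_cons _ (recursive_var0 _).
      exact: recursive_ctx_drop2.
    apply: recursive_all; first exact: recursive_var0.
    apply: recursive_leq; first exact: recursive_const.
    pose W (q : ctx n.+3) : ctx n.+2 := (q.1.1.1, q.2, q.1.1.2).
    apply: (recursive_subst (W := W)) rF _.
    apply: recursive_ctx_cons _ (recursive_var2 _).
    apply: recursive_ctx_cons _ (recursive_var0 _).
    exact: recursive_ctx_weak (recursive_ctx_drop2 _).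
  + move=> /sumE[/andP[/eqP Fy /allP lty] lt_ys]; apply/sumE.
    split; last exact: leq_trans le_st.
    rewrite /P (Fmono _ _ _ _ le_st Fy) eqxx; apply/allP => k /lty.
    by case E: (F _ _) => [//|z]; rewrite (Fmono _ _ _ _ le_st E).
  split=> [/= [/FP[s0]]|[s /sumE[/andP[/eqP Fy /allP lty] _]] /=].
    rewrite ctx_of_cons => E0 ltF.
    have /choice[w wP] k : exists w : nat * nat, k < y -> F (ctx_of v, k) w.2 = w.1.+2.
      case: (ltnP k y) => [lt_ky|]; last by exists (0, 0).
      have [z /FP[s E]] := ltF k lt_ky; exists (z, s) => _.
      by rewrite ctx_of_cons in E.
    (* The bound must also exceed [y], because the sum only ranges over [y < s]. *)
    pose s := maxn y.+1 (maxn s0 (\max_(k < y) (w k).2)).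
    exists s; apply/sumE; split; last exact: leq_maxl.
    have le_s0 : s0 <= s by rewrite /s !leq_max leqnn orbT.
    rewrite /P (Fmono _ _ _ _ le_s0 E0) eqxx; apply/allP => k.
    rewrite mem_iota => lt_ky; have le_ws : (w k).2 <= s.
      by rewrite /s !leq_max (leq_bigmax (Ordinal lt_ky)) !orbT.
    by rewrite (Fmono _ _ _ _ le_ws (wP k lt_ky)).
  split=> [|k lt_ky]; first by apply/FP; exists s; rewrite ctx_of_cons.
  have := lty k; rewrite mem_iota => /(_ lt_ky).
  case E: (F _ _) => [//|[//|z]] _; exists z.
  by apply/FP; exists s; rewrite ctx_of_cons.
Qed.

(** Both machines built below, the decompressor and the enumerator of the c.e. set, have this form:
    [Mu] finds the first [z] passing a total test, then a total function gives the output. *)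
Lemma unbounded_search n (T : ctx n -> nat -> bool) (F : ctx n -> nat -> nat) :
    recursive n.+1 (fun p => T p.1 p.2) -> recursive n.+1 (fun p => F p.1 p.2) ->
  exists f : murec n, forall v y, eval f v y <->
    exists z, [/\ T (ctx_of v) z, forall k, T (ctx_of v) k -> z <= k
                 & y = F (ctx_of v) z].
Proof.
move=> /recursive_not[t tP] [f fP].
exists (Comp f (fun i => if unlift ord0 i is Some j then Proj j else Mu t)) => v y.
have tE z : eval t [tuple of z :: v] (~~ T (ctx_of v) z).
  by have := tP [tuple of z :: v]; rewrite ctx_of_cons.
have muE z : eval (Mu t) v z <-> T (ctx_of v) z /\ forall k, T (ctx_of v) k -> z <= k.
  split=> /= [[tz ltz]|[Tz minz]].
    split=> [|k Tk]; first by have := eval_fun tz (tE z); case: (T _ z).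
    rewrite leqNgt; apply/negP => /ltz[y' ty'].
    by have := eval_fun ty' (tE k); rewrite Tk.
  split=> [|k lt_kz]; first by have := tE z; rewrite Tz.
  exists 0; have := tE k; case: (boolP (T _ k)) => // /minz.
  by rewrite leqNgt lt_kz.
split=> /= [[w wP fw]|[z [Tz minz ->]]].
  have wE : w = [tuple of tnth w ord0 :: v].
    apply: eq_from_tnth => i; case: (unliftP ord0 i) (wP i) => [j|] -> //= ->.
    by rewrite tnthS.
  have := wP ord0; rewrite unlift_none => /muE[Tz minz].
  exists (tnth w ord0); split=> //.
  by have := fP w; rewrite {2}wE ctx_of_cons; apply: eval_fun.
exists [tuple of z :: v] => [i|]; last first.
  by have := fP [tuple of z :: v]; rewrite ctx_of_cons.
by case: (unliftP ord0 i) => [j|] -> /=; [rewrite tnthS | apply/muE].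
Qed.

Lemma clock1 (f : murec 1) :
  exists V : nat -> nat -> nat,
    [/\ recursive 2 (fun p => V p.1.2 p.2),
        forall k s t y, s <= t -> V k s = y.+1 -> V k t = y.+1
      & forall k y, eval f [tuple k] y <-> exists s, V k s = y.+1].
Proof.
have [G [rG Gmono GP]] := clock f; exists (fun k => G (tt, k)); split.
- by apply: recursive_ext rG _ => -[[[] k] s].
- by move=> k s t y; apply: Gmono.
- by move=> k y; apply: GP.
Qed.

(** * Binary expansions and Kraft's inequality *)

(** In bijective base 2 a bit [b] is the digit [b.+1]; written as a bounded sum, the numeral is
    visibly recursive. *)
Lemma nat_of_str_mkseq (b : nat -> bool) n :
  nat_of_str (mkseq b n) = \sum_(0 <= i < n) (b i).+1 * 2 ^ i.
Proof.
elim: n b => [|n IHn] b; first by rewrite big_geq.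
rewrite big_nat_recl //= /mkseq (iotaDl 1 0) -map_comp -[map _ _]/(mkseq (b \o S) n) IHn.
rewrite muln1 -addnS addnC -mul2n big_distrr /=; congr (_ + _).
by apply: eq_bigr => i _; rewrite expnS mulnCA.
Qed.

Lemma recursive_str n (b : ctx n -> nat -> bool) (B : ctx n -> nat) :
  recursive n.+1 (fun p => b p.1 p.2) -> recursive n B ->
  recursive n (fun x => nat_of_str (mkseq (b x) (B x))).
Proof.
move=> rb rB.
have r : recursive n (fun x => \sum_(0 <= i < B x) (b x i).+1 * 2 ^ i).
  apply: recursive_sum rB _; apply: recursive_mul; first exact: recursive_succ rb.
  by apply: recursive_exp; [exact: recursive_const | exact: recursive_var0].
by apply: recursive_ext r _ => x; rewrite nat_of_str_mkseq.
Qed.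

(** The strings of length [l] have the numerals from [2 ^ l - 1] to [2 ^ l.+1 - 2]. This bound and
    the next one convert between lengths and numerals with a loss of one bit. *)
Lemma nat_of_str_lt s : (nat_of_str s).+1 < 2 ^ (size s).+1.
Proof. by elim: s => //= b s IHs; rewrite expnS; case: b; lia. Qed.

Lemma nat_of_str_ge s : 2 ^ size s <= (nat_of_str s).+1.
Proof. by elim: s => //= b s IHs; rewrite expnS; case: b; lia. Qed.

Definition bit a i := odd (a %/ 2 ^ i).

Lemma recursive_bit n (F G : ctx n -> nat) :
  recursive n F -> recursive n G -> recursive n (fun x => bit (F x) (G x)).
Proof.
move=> rF rG; apply: recursive_odd; apply: recursive_div rF _.
exact: recursive_exp (recursive_const n 2) rG.
Qed.

Lemma bit_half a i : bit a i.+1 = bit a./2 i.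
Proof. by rewrite /bit expnS divnMA divn2. Qed.

Lemma bit_inj k a b : a < 2 ^ k -> b < 2 ^ k ->
  (forall i, i < k -> bit a i = bit b i) -> a = b.
Proof.
elim: k a b => [|k IHk] a b; first by rewrite expn0 !ltnS !leqn0 => /eqP-> /eqP->.
rewrite expnS => lta ltb E.
have /= := E 0 isT; rewrite /bit !divn1 => odd_ab.
rewrite -(odd_double_half a) -(odd_double_half b) odd_ab; congr (_ + _.*2).
apply: IHk => [||i lt_ik]; [lia|lia|].
by rewrite -!bit_half E.
Qed.

(** There is no carry, as the digit at [x] is 0. This is how an element is added to a finite set
    coded by a number. *)
Lemma bit_set a x i : ~~ bit a x -> bit (a + 2 ^ x) i = bit a i || (i == x).
Proof.
elim: x a i => [|x IHx] a [|i].
- by rewrite /bit expn0 !divn1 oddD /= => /negPf->.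
- rewrite orbF !bit_half /bit expn0 !divn1 => Na; congr (odd (_ %/ _)); lia.
- by rewrite orbF /bit expn0 !divn1 oddD oddX /= addbF.
- rewrite !bit_half => Na; rewrite eqSS -IHx //; congr (bit _ _).
  by rewrite expnS halfD oddM /= andbF mul2n doubleK.
Qed.

(** With the most significant digit first, keeping only [k] of [l] digits drops the [l - k] lowest
    ones. *)
Lemma prefix_msb k l a b : k <= l -> a < 2 ^ k -> b < 2 ^ l ->
  prefix (mkseq (fun i => bit a (k - i.+1)) k) (mkseq (fun i => bit b (l - i.+1)) l) ->
  a = b %/ 2 ^ (l - k).
Proof.
move=> le_kl lta ltb; rewrite prefixE => /eqP pre; apply: (@bit_inj k) => // [|i lt_ik].
  by rewrite ltn_divLR ?expn_gt0 // -expnD subnKC.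
have lt_jk : k - i.+1 < k by lia.
have := congr1 (fun s => nth false s (k - i.+1)) pre.
rewrite size_mkseq nth_take // !nth_mkseq //; last exact: leq_trans le_kl.
rewrite (_ : k - (k - i.+1).+1 = i); last by lia.
rewrite (_ : l - (k - i.+1).+1 = (l - k) + i); last by lia.
by rewrite /bit expnD divnMA.
Qed.

(** Induction on a bound [L] for the lengths. The empty word can only occur alone; otherwise the
    words are split by their first bit, and each half, with that bit removed, is again prefix-free
    and so contributes at most 1/2. *)
Lemma kraft (R : realType) (S : seq (seq bool)) :
  uniq S -> {in S &, forall p q, prefix p q -> p = q} ->
  (\sum_(p <- S) 2 ^- size p <= 1 :> R)%R.
Proof.
have [L] : exists L, all (fun p => size p < L) S.
  exists (\max_(p <- S) size p).+1; apply/allP => p pS.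
  by rewrite ltnS; apply: leq_bigmax_seq.
elim: L S => [|L IHL] S sS uS pS.
  by case: S sS {uS pS} => //; rewrite big_nil ler01.
have [nilS|nilNS] := boolP ([::] \in S).
  have -> : S = [:: [::]]; last by rewrite big_seq1 expr0 invr1.
  have /perm_small_eq -> // : perm_eq S [:: [::]].
  apply: uniq_perm => // p; rewrite inE; apply/idP/eqP => [pinS|-> //].
  by rewrite -(pS _ _ nilS pinS (prefix0s _)).
pose T b := [seq behead p | p <- S & head false p == b].
have half b : (\sum_(p <- S | head false p == b) 2 ^- size p <= 2^-1 :> R)%R.
  have consE p : p \in S -> head false p == b -> p = b :: behead p.
    by case: p => [|c p]; [rewrite (negPf nilNS) | move=> _ /eqP <-].
  have -> : (\sum_(p <- S | head false p == b) 2 ^- size p =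
             2^-1 * \sum_(p <- T b) 2 ^- size p :> R)%R.
    rewrite big_map big_filter big_distrr /= [LHS]big_seq_cond [RHS]big_seq_cond.
    apply: eq_bigr => p /andP[pinS hp].
    by rewrite [in LHS](consE p pinS hp) /= exprS invfM.
  rewrite ger_pMr ?invr_gt0 ?ltr0n //; apply: IHL.
  - apply/allP => q /mapP[p]; rewrite mem_filter => /andP[hp pinS] ->.
    by have := allP sS p pinS; rewrite (consE p pinS hp).
  - rewrite map_inj_in_uniq ?filter_uniq // => p q.
    rewrite !mem_filter => /andP[hp pinS] /andP[hq qinS] E.
    by rewrite (consE p) // (consE q) // E.
  - move=> p' q' /mapP[p + ->] /mapP[q + ->].
    rewrite !mem_filter => /andP[hp pinS] /andP[hq qinS] pre; congr behead.
    by apply: pS => //; rewrite (consE p) // (consE q) //= eqxx.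
rewrite (bigID (fun p => head false p == true)) /=.
rewrite [leRHS](_ : _ = 2^-1 + 2^-1)%R; last by rewrite [LHS]splitr mul1r.
apply: lerD; first exact: half.
by under eq_bigl => p do rewrite eqb_id -eqbF_neg; apply: half.
Qed.

(** * Compressing c.e. sets *)

(* The word of [(n, m)], for [m <= n], is the binary expansion of the left end
   of its interval in the Kraft code, which is
   [\sum_(i < n) i.+1 * 2 ^- len i + m * 2 ^- len n]
   (and [pos n] is the first sum scaled by [2 ^ len n]). No online allocation
   is needed, because the lengths are nondecreasing in [n]. *)
Definition len h d n := h n + trunc_log 2 n + d.+1.

Definition pos h d n :=
  \sum_(0 <= i < n) i.+1 * 2 ^ (len h d n - len h d i).

Definition word h d n m :=
  mkseq (fun i => bit (pos h d n + m) (len h d n - i.+1)) (len h d n).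

Lemma len_mono h d m n : (forall i j, i <= j -> h i <= h j) -> m <= n ->
  len h d m <= len h d n.
Proof.
by move=> hmono le_mn; rewrite leq_add2r leq_add ?hmono // leq_trunc_log.
Qed.

(** The [i.+1] words for [i] have total weight at most [2 ^- d * 2 ^- h i], because
    [i.+1 <= 2 ^ (trunc_log 2 i).+1]; the extra bit in [d.+1] pays for rounding the logarithm. The
    bound on the sums makes the total at most 1. *)
Lemma pos_lt (R : realType) h d n : (forall i j, i <= j -> h i <= h j) ->
  (forall N, \sum_(0 <= i < N) 2 ^- h i <= 2 ^+ d :> R)%R ->
  pos h d n + n.+1 <= 2 ^ len h d n.
Proof.
move=> hmono sum_le.
have -> : pos h d n + n.+1 = \sum_(0 <= i < n.+1) i.+1 * 2 ^ (len h d n - len h d i).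
  by rewrite big_nat_recr //= subnn muln1.
rewrite -(ler_nat R) natr_sum.
have term i : 0 <= i < n.+1 -> ((i.+1 * 2 ^ (len h d n - len h d i))%:R <=
    2 ^+ len h d n * 2 ^- d * 2 ^- h i :> R)%R.
  rewrite /= ltnS => le_in.
  rewrite natrM natrX -mulrA -[X in (_ <= X)%R]mulrC.
  have E : (2 ^+ len h d n = 2 ^+ (len h d n - len h d i) * 2 ^+ len h d i :> R)%R.
    by rewrite -exprD subnK // len_mono.
  rewrite E /len !exprD.
  have -> : (2 ^- d * 2 ^- h i * (2 ^+ (len h d n - len h d i) *
     (2 ^+ h i * 2 ^+ trunc_log 2 i * 2 ^+ d.+1)) =
     2 ^+ (trunc_log 2 i).+1 * 2 ^+ (len h d n - len h d i) :> R)%R.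
    rewrite !exprS; field.
    by rewrite !expf_neq0 // pnatr_eq0.
  rewrite ler_wpM2r ?exprn_ge0 ?ler0n // -natrX ler_nat.
  exact: trunc_log_ltn.
apply: le_trans (_ : _ <= \sum_(0 <= i < n.+1) 2 ^+ len h d n * 2 ^- d * 2 ^- h i)%R _.
  by rewrite big_nat_cond [leRHS]big_nat_cond; apply: ler_sum => i /andP[/term].
rewrite -big_distrr /= -mulrA natrX ger_pMr ?exprn_gt0 ?ltr0n //.
by rewrite ler_pdivrMl ?exprn_gt0 ?ltr0n // mulr1.
Qed.

(** After rescaling, the left side consists of the terms of [pos h d n] with index at most [m]. *)
Lemma pos_step h d m n : (forall i j, i <= j -> h i <= h j) -> m < n ->
  (pos h d m + m.+1) * 2 ^ (len h d n - len h d m) <= pos h d n.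
Proof.
move=> hmono lt_mn.
have -> : pos h d m + m.+1 = \sum_(0 <= i < m.+1) i.+1 * 2 ^ (len h d m - len h d i).
  by rewrite big_nat_recr //= subnn muln1.
rewrite /pos (big_cat_nat (leq0n m.+1) lt_mn) /= big_distrl /=.
apply: leq_trans (leq_addr _ _); rewrite big_nat_cond [leqRHS]big_nat_cond.
apply: leq_sum => i /andP[/andP[_]]; rewrite ltnS => le_im _.
have := len_mono d hmono le_im; have := len_mono d hmono (ltnW lt_mn).
move=> le1 le2; rewrite -mulnA -expnD leq_mul2l leq_exp2l //=; lia.
Qed.

(** A prefix corresponds to an interval containing that of the longer word, while [pos_step]
    separates the intervals belonging to different [n]. *)
Lemma word_prefix h d n m n' m' : (forall i j, i <= j -> h i <= h j) ->
  (forall n, pos h d n + n.+1 <= 2 ^ len h d n) -> m <= n -> m' <= n' ->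
  prefix (word h d n m) (word h d n' m') -> n = n' /\ m = m'.
Proof.
move=> hmono fit le_mn le_mn' pre.
have le_len : len h d n <= len h d n'.
  by have := size_prefix pre; rewrite !size_mkseq.
have lt_pos k j : j <= k -> pos h d k + j < 2 ^ len h d k.
  by move=> le_jk; apply: leq_trans (fit k); rewrite ltn_add2l ltnS.
have E := prefix_msb le_len (lt_pos _ _ le_mn) (lt_pos _ _ le_mn') pre.
case: (ltngtP n n') => [lt_n|lt_n|eq_n].
- have := pos_step d hmono lt_n => le_pos; exfalso.
  have : pos h d n + n.+1 <= pos h d n + m.
    rewrite E leq_divRL ?expn_gt0 //; apply: leq_trans le_pos _; exact: leq_addr.
  by rewrite leq_add2l ltnNge le_mn.
(* Lengths are monotone in [n] and a prefix is not longer than its extension, so here the two words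
   have equal length. *)
- have eq_len : len h d n' = len h d n.
    by apply/eqP; rewrite eqn_leq le_len len_mono // ltnW.
  have := pos_step d hmono lt_n; move: E; rewrite eq_len subnn expn0 divn1 muln1.
  lia.
- by subst n'; move: E; rewrite subnn expn0 divn1 => /addnI.
Qed.

Lemma recursive_len h d n (F : ctx n -> nat) : recursive 1 (fun p => h p.2) ->
  recursive n F -> recursive n (fun x => len h d (F x)).
Proof.
move=> rh rF; apply: recursive_add (recursive_const _ _).
by apply: recursive_add; [apply: recursive1 | apply: recursive_log].
Qed.

Lemma recursive_pos h d n (F : ctx n -> nat) : recursive 1 (fun p => h p.2) ->
  recursive n F -> recursive n (fun x => pos h d (F x)).
Proof.
move=> rh rF; apply: (recursive_sum rF).
apply: recursive_mul; first exact/recursive_succ/recursive_var0.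
apply: recursive_exp; first exact: recursive_const.
apply: recursive_sub; last exact: recursive_len rh (recursive_var0 _).
exact: recursive_len rh (recursive_weak rF).
Qed.

Lemma recursive_word h d n (F G : ctx n -> nat) : recursive 1 (fun p => h p.2) ->
  recursive n F -> recursive n G ->
  recursive n (fun x => nat_of_str (word h d (F x) (G x))).
Proof.
move=> rh rF rG.
apply: (@recursive_str n (fun x i => bit (pos h d (F x) + G x) (len h d (F x) - i.+1)));
  last exact: recursive_len.
apply: recursive_bit.
  apply: recursive_add; last exact: recursive_weak.
  exact: recursive_pos rh (recursive_weak rF).
apply: recursive_sub; last exact/recursive_succ/recursive_var0.
exact: recursive_len rh (recursive_weak rF).
Qed.

(* On input [word n m] the machine enumerates [A] until [m] elements below [n]
   have appeared; its output is then written as a sum over all [n' <= z] with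
   a single nonzero term. *)
Lemma word_machine h d (A : set nat) :
    recursive 1 (fun p => h p.2) -> (forall i j, i <= j -> h i <= h j) ->
    (forall n, pos h d n + n.+1 <= 2 ^ len h d n) -> ce A ->
  exists2 M, prefix_free M &
    forall n, outputs M (word h d n (\sum_(0 <= i < n) `[< A i >])) (restr A n).
Proof.
move=> rh hmono fit [f fA]; have [V [rV Vmono VP]] := clock1 f.
pose b z i := 0 < V i z.
have bA z i : b z i -> A i.
  by rewrite /b; case E: (V i z) => [//|y] _; apply/fA; exists y; apply/VP; exists z.
have bmono z z' i : z <= z' -> b z i -> b z' i.
  by rewrite /b => le_z; case E: (V i z) => [//|y] _; rewrite (Vmono _ _ _ _ le_z E).
(* Stage [z] bounds both the enumeration of [A] and, in [rS], the candidates [n], so the search over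
   [z] alone covers everything. *)
pose T e z n := has (fun m => (nat_of_str (word h d n m) == e) &&
                        (m <= \sum_(0 <= i < n) b z i)) (iota 0 n.+1).
have rb : recursive 2 (fun p => b p.1.2 p.2).
  apply: recursive_leq; first exact: recursive_const.
  exact: recursive2 rV (recursive_var0 _) (recursive_var1 _).
have rT : recursive 3 (fun p => T p.1.1.2 p.1.2 p.2).
  apply: recursive_has; first exact/recursive_succ/recursive_var0.
  apply: recursive_and.
    apply: recursive_eq (recursive_var3 _).
    exact: recursive_word rh (recursive_var1 _) (recursive_var0 _).
  apply: (recursive_leq (recursive_var0 _)).
  apply: recursive_sum (recursive_var1 _) _.
  exact: (recursive2 (f := fun z i => b z i)) rb (recursive_var3 _) (recursive_var0 _).
have rS : recursive 2 (fun p => has (T p.1.2 p.2) (iota 0 p.2.+1)).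
  by apply: recursive_has rT; apply/recursive_succ/recursive_var0.
have rO : recursive 2 (fun p =>
    \sum_(0 <= n < p.2.+1) nat_of_str (mkseq (b p.2) n) * T p.1.2 p.2 n).
  apply: recursive_sum; first exact/recursive_succ/recursive_var0.
  apply: (recursive_mul _ rT); apply: recursive_str (recursive_var0 _).
  exact: (recursive2 (f := fun z i => b z i)) rb (recursive_var2 _) (recursive_var0 _).
have [M MP] := @unbounded_search 1 (fun x z => has (T x.2 z) (iota 0 z.+1))
  (fun x z => \sum_(0 <= n < z.+1) nat_of_str (mkseq (b z) n) * T x.2 z n) rS rO.
have TP e z n : T e z n -> exists m, [/\ m <= n, nat_of_str (word h d n m) = e
    & m <= \sum_(0 <= i < n) b z i].
  by move=> /hasP[m]; rewrite mem_iota ltnS => le_mn /andP[/eqP ? ?]; exists m.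
exists M.
  have Mword p x : outputs M p x -> exists n m, m <= n /\ p = word h d n m.
    move=> /MP[z [/hasP[n _ /TP[m [le_mn E _]] _ _]]].
    by exists n, m; split=> //; apply/nat_of_str_inj.
  move=> p q x y /Mword[n [m [le_mn ->]]] /Mword[n' [m' [le_mn' ->]]] pre.
  by have [-> ->] := word_prefix hmono fit le_mn le_mn' pre.
move=> n; set m := \sum_(0 <= i < n) `[< A i >].
have le_mn : m <= n.
  rewrite -[leqRHS]muln1 -[X in X * 1]subn0 -sum_nat_const_nat.
  by apply: leq_sum => i _; apply: leq_b1.
have uT z : {in T (nat_of_str (word h d n m)) z &, forall j k, j = k}.
  have TE j : T (nat_of_str (word h d n m)) z j -> n = j.
    move=> /TP[m' [le_mj /nat_of_str_inj E _]].
    have pre : prefix (word h d n m) (word h d j m') by rewrite E prefix_refl.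
    by have [] := word_prefix hmono fit le_mn le_mj pre.
  by move=> j k /TE <- /TE <-.
have exT : exists z, has (T (nat_of_str (word h d n m)) z) (iota 0 z.+1).
  have /choice[s sP] i : exists s, A i -> b s i.
    case: (pselect (A i)) => [/fA[y /VP[s E]]|NA]; last by exists 0.
    by exists s; rewrite /b E.
  pose z := maxn n (\max_(i < n) s i); exists z.
  apply/hasP; exists n; first by rewrite mem_iota ltnS leq_maxl.
  apply/hasP; exists m; first by rewrite mem_iota ltnS.
  rewrite eqxx /= /m !big_mkord; apply: leq_sum => i _.
  case: asboolP => // /sP bi; rewrite (bmono _ _ _ _ bi) //.
  by rewrite leq_max (leq_bigmax i) orbT.
apply/MP => /=; case: (ex_minnP exT) => z Tz minz; exists z.
split=> //; have [n' lt_nz Tn] := hasP Tz.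
rewrite mem_iota in lt_nz.
rewrite (sum_nat_unique (fun k => nat_of_str (mkseq (b z) k)) (uT z) Tn lt_nz).
have [m' [le_mn' /nat_of_str_inj E le_sum]] := TP _ _ _ Tn.
have pre : prefix (word h d n m) (word h d n' m') by rewrite E prefix_refl.
have [? ?] := word_prefix hmono fit le_mn le_mn' pre; subst n' m'.
congr nat_of_str; apply/eq_in_map => i; rewrite mem_iota => /= lt_in.
(* The stage [z] approximation lies pointwise below [A], yet its sum up to [n] reaches [m], so the
   two agree below [n]. *)
have sub j : b z j <= `[< A j >].
  by case: (boolP (b z j)) => // /bA Aj; rewrite asboolT.
have := (leqif_sum (fun (j : 'I_n) (_ : true) => leqif_eq (sub j))).2.
rewrite -!(big_mkord xpredT (fun j => nat_of_bool (b z j))).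
rewrite -!(big_mkord xpredT (fun j => nat_of_bool `[< A j >])).
rewrite eqn_leq le_sum leq_sum // => /esym/forallP/(_ (Ordinal lt_in))/=/eqP.
by case: (b z i); case: `[< A i >].
Qed.

(** * From summability to a bound on complexity *)

Lemma summable_bound (R : realType) (h : nat -> nat) :
  (\sum_(0 <= n <oo) ((2 ^- h n)%R : R)%:E < +oo)%E ->
  exists d, forall N, (\sum_(0 <= n < N) 2 ^- h n <= 2 ^+ d :> R)%R.
Proof.
have t0 n : (0 <= ((2 ^- h n)%R : R)%:E)%E by rewrite lee_fin invr_ge0 exprn_ge0.
set S := (\sum_(0 <= n <oo) _)%E => S_lt.
have S_fin : S \is a fin_num by rewrite ge0_fin_numE // nneseries_ge0.
have S_ge0 : (0 <= fine S)%R by rewrite fine_ge0 // nneseries_ge0.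
(* A bound that is a power of 2 costs just [d] extra bits per word. *)
exists (Num.bound (fine S)) => N; rewrite -lee_fin -sumEFin.
apply: le_trans (nneseries_lim_ge N _) _ => //; rewrite -/S -(fineK S_fin) lee_fin.
apply/ltW/(lt_le_trans (archi_boundP S_ge0)).
by rewrite -natrX ler_nat ltnW // ltn_expl.
Qed.

Lemma ln2_gt0 (R : realType) : (0 < ln 2 :> R)%R.
Proof. by rewrite ln_gt0 // ltr1n. Qed.

Lemma trunc_log_le_log2 (R : realType) n : 0 < n ->
  ((trunc_log 2 n)%:R <= log2 (n%:R : R))%R.
Proof.
move=> n0; rewrite /log2 ler_pdivlMr ?ln2_gt0 // mulr_natl -lnXn ?ltr0n //.
by rewrite ler_ln ?posrE ?exprn_gt0 ?ltr0n // -natrX ler_nat trunc_logP.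
Qed.

Lemma complexity_le_of_summable (R : realType) (U : murec 1) (h : nat -> nat) A :
    optimal U -> computable h -> (forall i j, i <= j -> h i <= h j) ->
    (\sum_(0 <= n <oo) ((2 ^- h n)%R : R)%:E < +oo)%E -> ce A ->
  exists c : R, forall n, 1 <= n ->
    (K R U (restr A n) <= ((h n)%:R + log2 (n%:R : R) + c)%R%:E)%E.
Proof.
move=> [_ optU] [f fh] hmono /summable_bound[d sum_le] ceA.
have rh : recursive 1 (fun p => h p.2).
  by exists f => v; case/tupleP: v => k v; rewrite (tuple0 v); apply: fh.
have [M pfM outM] := word_machine rh hmono (fun n => pos_lt n hmono sum_le) ceA.
(* [d.+1] comes from the length of the words, [c] from simulating [M] by [U]. *)
have [c Uc] := optU M pfM; exists (d.+1 + c)%:R%R => n n0.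
have [q Uq le_q] := Uc _ _ (outM n).
apply: le_trans (ereal_inf_lbound _) _; first by exists q.
rewrite lee_fin size_mkseq in le_q *.
apply: (@le_trans _ _ ((h n)%:R + (trunc_log 2 n)%:R + (d.+1 + c)%:R)%R).
  by rewrite -!natrD ler_nat addnA.
by rewrite lerD2r lerD2l trunc_log_le_log2.
Qed.

(** * A c.e. set with complex initial segments *)

(* The bound on the numeral [p] says, up to an additive constant, that the
   string it codes has length at most [h n + log2 n + c]. *)
Definition described (V : nat -> nat -> nat) h c n a s :=
  has (fun p => V p s == (nat_of_str (mkseq (bit a) n)).+1)
    (iota 0 (n * 2 ^ (h n + c.+1))).

(* The set of numbers enumerated so far is coded by the binary digits of [a].
   The constant attached to [x] is [logn 2 x.+1], so that every constant is
   attached to a set of numbers of positive density. *)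
Definition ready V h x a s :=
  ~~ bit a x &&
  all (fun j => described V h (logn 2 x.+1) (x + j.+1) a s) (iota 0 x).

(* Stage [s] attends to [logn 2 s], so every number is attended to infinitely
   often. *)
Fixpoint stage V h s :=
  if s is t.+1 then
    stage V h t + 2 ^ logn 2 s * ready V h (logn 2 s) (stage V h t) t
  else 0.

Lemma bit_stageS V h s i : bit (stage V h s.+1) i =
  bit (stage V h s) i ||
    ((i == logn 2 s.+1) && ready V h (logn 2 s.+1) (stage V h s) s).
Proof.
rewrite [stage V h s.+1]/=; case: (boolP (ready _ _ _ _ _)) => [/andP[Nb _]|_].
  by rewrite muln1 bit_set // andbT.
by rewrite muln0 addn0 andbF orbF.
Qed.

Lemma bit_stage0 V h i : bit (stage V h 0) i = false.
Proof. by rewrite /bit div0n. Qed.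

Lemma bit_stage_mono V h s t i :
  s <= t -> bit (stage V h s) i -> bit (stage V h t) i.
Proof.
move=> /subnKC<-; elim: (t - s) => [|k IHk] bi; first by rewrite addn0.
by rewrite addnS bit_stageS IHk.
Qed.

Lemma bit_stage_ready V h s x : bit (stage V h s) x ->
  exists t, [/\ x = logn 2 t.+1, ready V h x (stage V h t) t & bit (stage V h t.+1) x].
Proof.
elim: s => [|s IHs]; first by rewrite bit_stage0.
rewrite bit_stageS => /orP[/IHs//|/andP[/eqP-> rs]].
by exists s; rewrite bit_stageS rs eqxx orbT.
Qed.

Lemma recursive_stage V h n (F : ctx n -> nat) :
    recursive 1 (fun p => h p.2) -> recursive 2 (fun p => V p.1.2 p.2) ->
  recursive n F -> recursive n (fun x => stage V h (F x)).
Proof.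
move=> rh rV rF.
pose f a s := a + 2 ^ logn 2 s.+1 * ready V h (logn 2 s.+1) a s.
apply: (@recursive_rec n (fun=> 0) (fun _ => f) (fun _ => stage V h)) => //.
  exact: recursive_const.
apply: recursive_add (recursive_var1 _) _; apply: recursive_mul.
  exact: recursive_exp (recursive_const _ _) (recursive_val2 (recursive_var0 _)).
apply: recursive_and.
  exact/recursive_not/recursive_bit/recursive_val2/recursive_var0/recursive_var1.
apply: recursive_all; first exact/recursive_val2/recursive_var0.
have rn : recursive n.+3 (fun p => logn 2 p.1.2.+1 + p.2.+1).
  apply: recursive_add; first exact/recursive_val2/recursive_var1.
  exact/recursive_succ/recursive_var0.
apply: recursive_has.
  apply: (recursive_mul rn); apply: recursive_exp; first exact: recursive_const.
  apply: recursive_add; first exact: (recursive1 rh).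
  apply: recursive_succ; apply: recursive_val2; exact/recursive_val2/recursive_var1.
apply: recursive_eq; first exact: recursive2 rV (recursive_var0 _) (recursive_var2 _).
apply: recursive_succ.
apply: (@recursive_str n.+4 (fun p => bit p.1.1.1.2)); last exact: (recursive_weak rn).
exact: recursive_bit (recursive_var4 _) (recursive_var0 _).
Qed.

(** The numbers with attached constant [c] in increasing order, an arithmetic progression with
    difference [2 ^ c.+1]. *)
Definition level c k := (2 ^ c * (2 * k).+1).-1.

Lemma levelS c k : (level c k).+1 = 2 ^ c * (2 * k).+1.
Proof. by rewrite prednK // muln_gt0 expn_gt0. Qed.

Lemma logn_level c k : logn 2 (level c k).+1 = c.
Proof.
rewrite levelS lognM ?expn_gt0 // pfactorK // logn_coprime ?addn0 //.
by rewrite coprime2n /= oddM.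
Qed.

(** The sum is cut into blocks of length [2 ^ c.+2], the distance between consecutive
    [2 * level c k]. The first block is bounded by its length; block [k.+1] lies at or beyond
    [2 * level c k]. *)
Lemma sum_le_sum_level (R : realType) (h : nat -> nat) c N :
    (forall i j, i <= j -> h i <= h j) ->
  (\sum_(0 <= i < (2 ^ c.+2 * N.+1)%N) 2 ^- h i <= 2 ^+ c.+2 +
     2 ^+ c.+2 * \sum_(0 <= k < N) 2 ^- h (2 * level c k)%N :> R)%R.
Proof.
move=> hmono; rewrite -natrX; pose D := 2 ^ c.+2; rewrite -/D.
have g_mono m n : m <= n -> (2 ^- h n <= 2 ^- h m :> R)%R.
  move=> le_mn; rewrite lef_pV2 ?posrE ?exprn_gt0 ?ltr0n //.
  by rewrite -!natrX ler_nat leq_exp2l // hmono.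
have card_le (m : nat) (b : R) : (forall i, D * m <= i -> (2 ^- h i <= b)%R) ->
    (\sum_((D * m)%N <= i < (D * m.+1)%N) 2 ^- h i <= D%:R * b)%R.
  move=> le_b; apply: le_trans (_ : _ <= \sum_((D * m)%N <= i < (D * m.+1)%N) b)%R _.
    rewrite big_nat [leRHS]big_nat; apply: ler_sum => i /andP[le_i _].
    exact: le_b.
  by rewrite sumr_const_nat -mulnBr subSnn muln1 mulr_natl.
elim: N => [|N IHN].
  have := card_le 0 1%R; rewrite muln0 mulr1 [X in (_ + _ * X)%R]big_geq // mulr0 addr0.
  by apply=> i _; rewrite invf_le1 ?exprn_gt0 ?ltr0n // exprn_ege1 ?ler1n.
rewrite (@big_cat_nat _ _ _ (D * N.+1)) ?leq_mul //=.
rewrite [X in (_ <= _ + _ * X)%R]big_nat_recr //=.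
rewrite mulrDr addrA; apply: lerD IHN _; apply: card_le => i le_i; apply: g_mono.
apply: leq_trans le_i; rewrite /D !expnS; have := levelS c N; nia.
Qed.

(** As [c < k] is strict, some description is shorter than [m + log2 n + k]. Passing to its numeral
    turns the logarithm into the integer factor [n], so that [described] can test the bound
    recursively. *)
Lemma short_description (R : realType) (U : murec 1) w m n k (c : R) :
    0 < n -> (c < k%:R)%R ->
    (K R U w <= (m%:R + log2 (n%:R : R) + c)%R%:E)%E ->
  exists2 p, p < n * 2 ^ (m + k.+1) & eval U [tuple p] (nat_of_str w).
Proof.
move=> n0 lt_c le_K.
have /ereal_inf_lt[_ [p Up <-]] : (K R U w < (m%:R + log2 (n%:R : R) + k%:R)%R%:E)%E.
  by apply: le_lt_trans le_K _; rewrite lte_fin ltrD2l.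
rewrite lte_fin => lt_p.
exists (nat_of_str p) => //; apply: leq_trans (ltnW (nat_of_str_lt p)) _.
rewrite expnS addnS expnS mulnCA leq_mul2l /=.
rewrite -(ler_nat R) natrM !natrX -ler_ln ?posrE ?mulr_gt0 ?exprn_gt0 ?ltr0n //.
rewrite lnM ?posrE ?exprn_gt0 ?ltr0n // !lnXn ?ltr0n //.
have -> : ln n%:R = (log2 n%:R * ln 2 :> R)%R.
  by rewrite /log2 divfK // gt_eqF // ln2_gt0.
rewrite -!(mulr_natl (ln 2)) -mulrDl ler_pM2r ?ln2_gt0 // natrD.
by rewrite [leRHS]addrCA addrA ltW.
Qed.

Lemma summable_of_complexity_le (R : realType) (U : murec 1) (h : nat -> nat) :
    prefix_free U -> computable h -> (forall i j, i <= j -> h i <= h j) ->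
    (forall A, ce A -> exists c : R, forall n, 1 <= n ->
      (K R U (restr A n) <= ((h n)%:R + log2 (n%:R : R) + c)%R%:E)%E) ->
  (\sum_(0 <= n <oo) ((2 ^- h n)%R : R)%:E < +oo)%E.
Proof.
move=> pfU [f fh] hmono compressible.
have rh : recursive 1 (fun p => h p.2).
  by exists f => v; case/tupleP: v => k v; rewrite (tuple0 v); apply: fh.
have [V [rV Vmono VP]] := clock1 U.
pose a := stage V h; pose A : set nat := fun x => exists s, bit (a s) x.
have ceA : ce A.
  have rb : recursive 2 (fun p => bit (a p.2) p.1.2).
    exact: recursive_bit (recursive_stage rh rV (recursive_var0 _)) (recursive_var1 _).
  have [g gP] := @unbounded_search 1 (fun x s => bit (a s) x.2) (fun _ _ => 0)
    rb (recursive_const _ _).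
  exists g => x; split=> [exs|[y /gP[s [bs _ _]]]]; last by exists s.
  by case: (ex_minnP exs) => s bs mins; exists 0; apply/gP; exists s.
have [c Kc] := compressible A ceA.
(* Positivity of [c0] ensures that no [level c0 k] is 0. *)
have [c0 c0_gt0 lt_c] : exists2 c0 : nat, 0 < c0 & (c < c0%:R)%R.
  exists (Num.bound `|c|%R).+1 => //; apply: le_lt_trans (ler_norm c) _.
  by apply: lt_trans (archi_boundP (normr_ge0 c)) _; rewrite ltr_nat.
have shortP n n0 := short_description n0 lt_c (Kc n n0).
(* If [x] stayed outside, then at a late stage attending to [x] the set below [2 * x] would be final
   and the short descriptions of its initial segments would have converged, so [x] would be ready
   and enter. *)
have fill x : logn 2 x.+1 = c0 -> A x.
  move=> xc; apply: contrapT => NA.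
  have /choice[p pP] n : exists p, 0 < n -> p < n * 2 ^ (h n + c0.+1) /\
      exists s, V p s = (nat_of_str (restr A n)).+1.
    case: n => [|n]; first by exists 0.
    by have [//|p lt_p /VP exs] := shortP n.+1; exists p.
  have /choice[s sP] n : exists s, 0 < n -> V (p n) s = (nat_of_str (restr A n)).+1.
    case: n => [|n]; first by exists 0.
    by have [//|_ [s sE]] := pP n.+1; exists s.
  have /choice[t tP] i : exists t, A i -> bit (a t) i.
    by case: (pselect (A i)) => [[t bt]|]; [exists t | exists 0].
  pose S := maxn (\max_(n < (2 * x).+1) s n) (\max_(i < 2 * x) t i).
  (* A stage not before [S] whose successor attends to [x]. *)
  pose N := level x S; have Nx : logn 2 N.+1 = x by apply: logn_level.
  have le_SN : S <= N.
    rewrite -ltnS levelS; apply: leq_trans (leq_pmull _ _); [lia|by rewrite expn_gt0].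
  have bA i : i < 2 * x -> bit (a N) i = `[< A i >].
    move=> lt_i; apply/idP/asboolP => [bi|/tP]; first by exists N.
    apply: bit_stage_mono; apply: leq_trans le_SN.
    by rewrite leq_max (leq_bigmax (Ordinal lt_i)) orbT.
  case: (boolP (bit (a N) x)) => [bx|Nbx]; first by apply: NA; exists N.
  apply: NA; exists N.+1; rewrite /a bit_stageS Nx eqxx -/a.
  apply/orP; right; rewrite /ready Nbx; apply/allP => j; rewrite mem_iota /= => lt_j.
  have n0 : 0 < x + j.+1 by rewrite addnS.
  have le_n : x + j.+1 < (2 * x).+1 by rewrite ltnS mul2n -addnn leq_add2l.
  have [lt_p _] := pP _ n0; apply/hasP; exists (p (x + j.+1)).
    by rewrite mem_iota xc.
  have le_s : s (x + j.+1) <= N.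
    apply: leq_trans le_SN.
    by rewrite leq_max (leq_bigmax (Ordinal le_n)).
  rewrite (Vmono _ _ _ _ le_s (sP _ n0)) eqSS; apply/eqP; congr nat_of_str.
  apply/eq_in_map => i; rewrite mem_iota /= => lt_i; rewrite bA //.
  by apply: leq_trans lt_i _; rewrite -ltnS.
(* [t x] is a stage at which [x] is still outside and ready, and right after which it is inside. *)
have /choice[t tP] x : exists t, logn 2 x.+1 = c0 ->
    [/\ x = logn 2 t.+1, ready V h x (a t) t & bit (a t.+1) x].
  case: (pselect (logn 2 x.+1 = c0)) => [xc|]; last by exists 0.
  by have [s /bit_stage_ready[t tP]] := fill x xc; exists t.
have /choice[q0 qP0] (xj : nat * nat) : exists q, logn 2 xj.1.+1 = c0 -> xj.2 < xj.1 ->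
    outputs U q (mkseq (bit (a (t xj.1))) (xj.1 + xj.2.+1)) /\
    2 ^ size q <= (xj.1 + xj.2.+1) * 2 ^ (h (xj.1 + xj.2.+1) + c0.+1).
  case: xj => x j /=.
  case: (pselect (logn 2 x.+1 = c0)) => [xc|]; last by exists [::].
  case: (ltnP j x) => [lt_jx|]; last by exists [::].
  have [_ /andP[_ /allP desc] _] := tP x xc.
  have := desc j; rewrite mem_iota => /(_ lt_jx)/hasP[p].
  rewrite mem_iota xc => /= lt_p /eqP Vp.
  have [q qp] := nat_of_str_surj p; exists q => _ _; split.
    by rewrite /outputs qp; apply/VP; exists (t x).
  by apply: leq_trans (nat_of_str_ge q) _; rewrite qp.
pose q x j := q0 (x, j).
have qP x j : logn 2 x.+1 = c0 -> j < x ->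
    outputs U (q x j) (mkseq (bit (a (t x))) (x + j.+1)) /\
    2 ^ size (q x j) <= (x + j.+1) * 2 ^ (h (x + j.+1) + c0.+1).
  exact: (qP0 (x, j)).
(* Once [x] has entered, the initial segments described for its sake are no
   longer initial segments of the current set, so they never count again. *)
have q_inj x j x' j' : logn 2 x.+1 = c0 -> j < x -> logn 2 x'.+1 = c0 -> j' < x' ->
    q x j = q x' j' -> x = x' /\ j = j'.
  move=> xc lt_j xc' lt_j' E.
  have [Uq _] := qP x j xc lt_j; have [Uq' _] := qP x' j' xc' lt_j'.
  rewrite E in Uq; have /nat_of_str_inj Es := eval_fun Uq Uq'.
  have En : x + j.+1 = x' + j'.+1.
    by have := congr1 size Es; rewrite !size_mkseq.
  have Eb i : i < x + j.+1 -> bit (a (t x)) i = bit (a (t x')) i.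
    move=> lt_i; have := congr1 (fun s => nth false s i) Es.
    by rewrite !nth_mkseq -?En.
  suff eq_x : x = x' by split=> //; apply/eqP; move: En; rewrite eq_x => /addnI[->].
  have [tx /andP[Nb _] bx] := tP x xc; have [tx' /andP[Nb' _] bx'] := tP x' xc'.
  case: (ltngtP (t x) (t x')) => [lt_t|lt_t|eq_t]; last by rewrite tx tx' eq_t.
    have := bit_stage_mono lt_t bx; rewrite -/a -Eb ?(negPf Nb) //; lia.
  have := bit_stage_mono lt_t bx'; rewrite -/a Eb ?(negPf Nb') //; lia.
pose x := level c0; have xS := levelS c0; have xc := logn_level c0.
have kraft_x N : (\sum_(0 <= k < N) 2 ^- h (2 * x k)%N <= 2 ^+ c0.+2 :> R)%R.
  pose Q := [seq q (x k) j | k <- iota 0 N, j <- iota 0 (x k)].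
  have mem_Q p : p \in Q -> exists k j, j < x k /\ p = q (x k) j.
    move=> /allpairsPdep[k [j [_ jx ->]]]; exists k, j.
    by rewrite mem_iota in jx.
  have uQ : uniq Q.
    apply: allpairs_uniq_dep => [|k _|]; [exact: iota_uniq|exact: iota_uniq|].
    move=> _ _ /allpairsPdep[k [j [_ jx ->]]] /allpairsPdep[k' [j' [_ jx' ->]]] /=.
    rewrite !mem_iota in jx jx' => E.
    have [eq_x ->] := q_inj _ _ _ _ (xc k) jx (xc k') jx' E.
    suff -> : k = k' by [].
    by have := xS k; rewrite eq_x xS => /eqP; rewrite eqn_pmul2l ?expn_gt0 //; lia.
  have pfQ : {in Q &, forall p p', prefix p p' -> p = p'}.
    move=> p p' /mem_Q[k [j [lt_j ->]]] /mem_Q[k' [j' [lt_j' ->]]].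
    have [Uq _] := qP _ _ (xc k) lt_j; have [Uq' _] := qP _ _ (xc k') lt_j'.
    exact: pfU Uq Uq'.
  have := kraft R uQ pfQ; rewrite big_allpairs_dep /=.
  (* Lengths of the described segments are at most [2 * x k], so each of the [x k] descriptions has
     at least a share [1 / x k] of the left side. In [c0.+2], [c0.+1] comes from [described] and one
     more from this factor 2. *)
  have inner k : (2 ^- c0.+2 * 2 ^- h (2 * x k)%N <=
      \sum_(j <- iota 0 (x k)) 2 ^- size (q (x k) j) :> R)%R.
    have xk0 : (0 < (x k)%:R :> R)%R.
      rewrite ltr0n -ltnS xS; apply: leq_trans (leq_pmulr _ _) => //.
      by rewrite -{1}(expn0 2) ltn_exp2l.
    have term j : j < x k -> (2 ^- c0.+2 * 2 ^- h (2 * x k)%N / (x k)%:R <=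
        2 ^- size (q (x k) j) :> R)%R.
      move=> lt_j; have [_ le_q] := qP _ _ (xc k) lt_j.
      rewrite -!invfM lef_pV2 ?posrE; last 2 first.
      - by apply: mulr_gt0 => //; apply: mulr_gt0; rewrite exprn_gt0 ?ltr0n.
      - by rewrite exprn_gt0 ?ltr0n.
      rewrite -!natrX -!natrM ler_nat; apply: leq_trans le_q _.
      have le_n : x k + j.+1 <= 2 * x k by lia.
      apply: leq_trans (leq_mul le_n _) _.
        have le_h : h (x k + j.+1) + c0.+1 <= h (2 * x k) + c0.+1.
          by rewrite leq_add2r; apply: hmono le_n.
        exact: leq_pexp2l le_h.
      rewrite expnD [2 ^ c0.+2]expnS; nia.
    apply: (@le_trans _ _ (\sum_(j <- iota 0 (x k))
       2 ^- c0.+2 * 2 ^- h (2 * x k)%N / (x k)%:R)%R).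
      rewrite big_const_seq count_predT size_iota iter_addr_0 -[leRHS]mulr_natr.
      by rewrite divfK // gt_eqF.
    rewrite [leLHS]big_seq [leRHS]big_seq; apply: ler_sum => j.
    by rewrite mem_iota => /term.
  move=> le1; rewrite -[leRHS]mulr1 -ler_pdivrMl ?exprn_gt0 ?ltr0n // big_distrr /=.
  by apply: le_trans le1; rewrite /index_iota subn0; apply: ler_sum.
pose D := 2 ^ c0.+2; have D0 : 0 < D by rewrite expn_gt0.
have t0 n : (0 <= ((2 ^- h n)%R : R)%:E)%E by rewrite lee_fin invr_ge0 exprn_ge0.
apply: le_lt_trans (ltry (2 ^+ c0.+2 + 2 ^+ c0.+2 * 2 ^+ c0.+2 : R)%R).
apply: lime_le; first exact: is_cvg_nneseries.
apply: nearW => N; rewrite sumEFin lee_fin.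
(* The partial sum is extended to a whole number of blocks. *)
apply: le_trans (_ : _ <= \sum_(0 <= i < (D * N.+1)%N) 2 ^- h i)%R _.
  have le_N : N <= D * N.+1 by nia.
  rewrite [leRHS](@big_cat_nat _ _ _ N) //= lerDl; apply: sumr_ge0 => i _.
  by rewrite invr_ge0 exprn_ge0.
by apply: le_trans (sum_le_sum_level R c0 N hmono) _; rewrite lerD2l ler_wpM2l ?exprn_ge0.
Qed.

Theorem theorem1p9 (R : realType) (U : murec 1) (hU : optimal U)
    (h : nat -> nat) (hcomp : computable h)
    (hmono : forall m n : nat, (m <= n)%N -> (h m <= h n)%N) :
  (forall A : set nat, ce A ->
     exists c : R, forall n : nat, (1 <= n)%N ->
       (K R U (restr A n) <= ((h n)%:R + log2 (n%:R : R) + c)%R%:E)%E)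
  <->
  (\sum_(0 <= n <oo) ((2 ^- h n)%R : R)%:E < +oo)%E.
Proof.
split=> [|summable A]; first by have [pfU _] := hU; apply: summable_of_complexity_le.
exact: complexity_le_of_summable.
Qed.
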